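(* Let $f\in\mathbb{C}[x,y]$ be a homogeneous polynomial of degree $d>1$ which is not of the form $g^r$ with $g\in\mathbb{C}[x,y]$ and $r>1$ an integer. If $f$ has a non-isolated singularity at the origin, then $N(f)=1$.
   Context: For $j=0,1,2$, $\Omega^j$ denotes the space of regular (polynomial) differential $j$-forms on $\mathbb{C}^2$, and $d:\Omega^j\to\Omega^{j+1}$ is the exterior derivative. The (algebraic) Brieskorn module of $f$ is $$B(f)=\frac{\Omega^2}{df\wedge d(\Omega^{0})},$$ regarded as a $\mathbb{C}[t]$-module on which $t$ acts as multiplication by the polynomial $f$. Let $B(f)_{tors}$ be the submodule of $\mathbb{C}[t]$-torsion elements of $B(f)$. It is known that there exists an integer $N>0$ with $t^N B(f)_{tors}=0$; the least such integer $N>0$ is called the torsion order of $f$ and is denoted $N(f)$. That $f$ has a non-isolated singularity at the origin means that the origin is a non-isolated point of the common zero set of $\partial f/\partial x$ and $\partial f/\partial y$ in $\mathbb{C}^2$. *)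

(* Defs.v *)
From HB Require Import structures.
From mathcomp Require Import all_boot all_order all_algebra.
(* mpoly must be imported before the analysis files: in the other order their
   notations clash. *)
From mathcomp Require Import mpoly complex ring.
From mathcomp Require Import boolp classical_sets reals topology normedtype.

Set Implicit Arguments.
Unset Strict Implicit.
Unset Printing Implicit Defensive.

Import Order.TTheory GRing.Theory Num.Theory numFieldNormedType.Exports.

Local Open Scope classical_set_scope.
Local Open Scope ring_scope.
Local Open Scope quotient_scope.

(* Polynomial differential forms on the affine plane with coordinates
   x = 'X_0 and y = 'X_1: the pair (P, Q) is the 1-form P dx + Q dy, and P
   also stands for the 2-form P dx /\ dy. *)
Notation Omega0 R := {mpoly R[i][2]} (only parsing).
Notation Omega1 R := ({mpoly R[i][2]} * {mpoly R[i][2]})%type (only parsing).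
Notation Omega2 R := {mpoly R[i][2]} (only parsing).

Section Forms.
Variable R : realType.
Implicit Types (f g h : Omega0 R) (a b c : Omega1 R).

Definition ext_d g : Omega1 R := (g^`M(0), g^`M(1)).

Definition wedge a b : Omega2 R := a.1 * b.2 - a.2 * b.1.

Lemma ext_dB g h : ext_d (g - h) = ext_d g - ext_d h.
Proof. by rewrite /ext_d !mderivB. Qed.

Lemma wedgeBr a b c : wedge a (b - c) = wedge a b - wedge a c.
Proof. by rewrite /wedge /=; ring. Qed.

Lemma wedgexx a : wedge a a = 0.
Proof. by rewrite /wedge (mulrC a.2) subrr. Qed.

Lemma wedge_ext_dM f g h :
  wedge (ext_d f) (ext_d (g * h)) =
  g * wedge (ext_d f) (ext_d h) + h * wedge (ext_d f) (ext_d g).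
Proof. by rewrite /wedge /= !mderivM; ring. Qed.

Lemma wedge_ext_d_horner_alg f (p : {poly R[i]}) :
  wedge (ext_d f) (ext_d (horner_alg f p)) = 0.
Proof.
elim/poly_ind: p => [|p c IHp].
  by rewrite rmorph0 /wedge /= !mderiv0 !mulr0 subrr.
have dc : ext_d (- c%:MP_[2] : Omega0 R) = 0.
  by rewrite /ext_d -mpolyCN !mderivC.
rewrite rmorphD rmorphM /= horner_algX horner_algC -mul_mpolyC mulr1.
rewrite -[c%:MP]opprK ext_dB dc subr0 wedge_ext_dM IHp wedgexx.
by rewrite !mulr0 addr0.
Qed.

Lemma wedge_ext_d_alg f (p : {poly R[i]}) g :
  wedge (ext_d f) (ext_d (horner_alg f p * g)) =
  horner_alg f p * wedge (ext_d f) (ext_d g).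
Proof. by rewrite wedge_ext_dM wedge_ext_d_horner_alg mulr0 addr0. Qed.

End Forms.

Section Brieskorn.
Variables (R : realType) (f : {mpoly R[i][2]}).

Definition df_wedge_d : {pred Omega2 R} :=
  fun w => `[< exists g : Omega0 R, w = wedge (ext_d f) (ext_d g) >].

Lemma df_wedge_dP (w : Omega2 R) :
  reflect (exists g : Omega0 R, w = wedge (ext_d f) (ext_d g))
          (w \in df_wedge_d).
Proof. exact: asboolP. Qed.

Lemma df_wedge_d_zmod_closed : zmod_closed df_wedge_d.
Proof.
split=> [|_ _ /df_wedge_dP[g ->] /df_wedge_dP[h ->]]; apply/df_wedge_dP.
  by exists 0; rewrite -[in RHS](subrr 0) ext_dB wedgeBr subrr.
by exists (g - h); rewrite ext_dB wedgeBr.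
Qed.

HB.instance Definition _ :=
  GRing.isZmodClosed.Build _ df_wedge_d df_wedge_d_zmod_closed.

Definition brieskorn : Type := Quotient.quot df_wedge_d.

HB.instance Definition _ := GRing.Zmodule.on brieskorn.

Definition form_class (w : Omega2 R) : brieskorn :=
  \pi_(Quotient.quot df_wedge_d) w.

Lemma form_class_is_zmod_morphism : zmod_morphism form_class.
Proof. by move=> w w'; rewrite /form_class raddfB. Qed.

HB.instance Definition _ :=
  GRing.isZmodMorphism.Build _ _ form_class form_class_is_zmod_morphism.

Lemma form_classP (w w' : Omega2 R) :
  form_class w = form_class w' <->
  exists g : Omega0 R, w - w' = wedge (ext_d f) (ext_d g).
Proof.
rewrite (rwP eqP) /form_class -Quotient.idealrBE.
by split=> /df_wedge_dP.
Qed.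

Lemma form_class_surj (m : brieskorn) : exists w, m = form_class w.
Proof.
by exists (repr (m : Quotient.quot df_wedge_d)); rewrite /form_class reprK.
Qed.

(* 'X acts as multiplication by f: [horner_alg f p] is p(f). *)
Definition brieskorn_scale (p : {poly R[i]}) (m : brieskorn) : brieskorn :=
  form_class (horner_alg f p * repr (m : Quotient.quot df_wedge_d)).

Lemma brieskorn_scaleE (p : {poly R[i]}) (w : Omega2 R) :
  brieskorn_scale p (form_class w) = form_class (horner_alg f p * w).
Proof.
apply/form_classP; set w' := repr _.
have /form_classP[g wg] : form_class w' = form_class w.
  by rewrite /form_class reprK.
by exists (horner_alg f p * g); rewrite -mulrBr wg wedge_ext_d_alg.
Qed.

Lemma brieskorn_scaleA p q m :
  brieskorn_scale p (brieskorn_scale q m) = brieskorn_scale (p * q) m.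
Proof.
by have [w ->] := form_class_surj m; rewrite !brieskorn_scaleE rmorphM mulrA.
Qed.

Lemma brieskorn_scale1 : left_id 1 brieskorn_scale.
Proof.
move=> m; have [w ->] := form_class_surj m.
by rewrite brieskorn_scaleE rmorph1 mul1r.
Qed.

Lemma brieskorn_scaleDr : right_distributive brieskorn_scale +%R.
Proof.
move=> p m n; have [w ->] := form_class_surj m.
have [w' ->] := form_class_surj n.
by rewrite -raddfD !brieskorn_scaleE mulrDr raddfD.
Qed.

Lemma brieskorn_scaleDl m :
  {morph brieskorn_scale^~ m : p q / p + q}.
Proof.
move=> p q /=; have [w ->] := form_class_surj m.
by rewrite !brieskorn_scaleE rmorphD mulrDl raddfD.
Qed.

HB.instance Definition _ := GRing.Zmodule_isLmodule.Build {poly R[i]} brieskorn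
  brieskorn_scaleA brieskorn_scale1 brieskorn_scaleDr brieskorn_scaleDl.

Lemma brieskorn_scaleX (w : Omega2 R) :
  ('X : {poly R[i]}) *: form_class w = form_class (f * w).
Proof. by rewrite [LHS]brieskorn_scaleE horner_algX. Qed.

End Brieskorn.

Definition torsion (A : nzRingType) (M : lmodType A) : set M :=
  [set m | exists2 a : A, a != 0 & a *: m = 0].

Section TorsionOrder.
Variables (R : realType) (f : {mpoly R[i][2]}).

Definition kills_torsion (N : nat) : Prop :=
  forall m : brieskorn f, torsion m -> ('X^N : {poly R[i]}) *: m = 0.

Definition is_torsion_order (N : nat) : Prop :=
  [/\ (0 < N)%N, kills_torsion N &
      forall M : nat, (0 < M)%N -> kills_torsion M -> (N <= M)%N].

(* The default value 0 is not a torsion order, so [torsion_order = N] with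
   0 < N entails that the torsion order exists. *)
Definition torsion_order : nat := xget 0%N [set N | is_torsion_order N].

(* Points of the plane are rows over R[i]^o, the copy of R[i] that carries the
   Euclidean topology. *)
Definition singular_locus : set 'rV[R[i]^o]_2 :=
  [set z : 'rV[R[i]^o]_2 | f^`M(0).@[z 0] = 0 /\ f^`M(1).@[z 0] = 0].

Definition nonisolated_singularity_at_origin : Prop :=
  singular_locus 0 /\ ~ isolated singular_locus 0.

End TorsionOrder.

(* Main.v *)
From HB Require Import structures.
Require Import Defs.
From mathcomp Require Import all_boot all_order all_algebra.
From mathcomp Require Import mpoly complex.
From mathcomp Require Import reals.
From mathcomp Require Import classical_sets ring zify.

(** Write {f, g} = f_x g_y - f_y g_x, the coefficient of df /\ dg, so that
    B(f) is the quotient of the polynomials by the image of {f, -}.  The torsion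
    order is at least 1 by convention; what has to be shown is that t kills the
    torsion: if p(f) w lies in the image of {f, -} for some p <> 0, then so does
    f w ([torsion_killed]).

    Since f is homogeneous of degree d, the operator {f, -} shifts degrees by
    d - 2.  Looking at p(f) w degree by degree and inducting on the degree k,
    one finds that f^(a+1) w_k lies in the image for every homogeneous component
    w_k of w, where a is the order of vanishing of p at 0
    ([torsion_component]).  Hence w may be taken homogeneous of degree k, with
    f^(a+1) w = {f, g} and g homogeneous of degree m = a d + k + 2.

    The point is now that f^a divides g: the homogeneous function g / f^a has
    the positive degree k + 2, and f w = {f, g / f^a} has no pole, which forces
    g / f^a to have none either.  To see this, put x = 1.  Euler's identity turns
    {f, g} into the weighted Wronskian d F G' - m F' G of the univariate
    polynomials F = f(1, y) and G = g(1, y) ([dehom_bracket]).  At a root of F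
    where F and G vanish to the orders e and s, the term of lowest order
    e + s - 1 of the Wronskian has the coefficient d s - m e, up to a nonzero
    factor.  If s were smaller than a e this coefficient would be negative, hence
    nonzero, and the Wronskian could not be divisible by F^(a+1)
    ([mup_le_of_dvd_wronskian]).  The line x = 0 is not seen in this chart; there
    the same computation is made with leading coefficients and bounds the degree
    of G ([size_le_of_wronskian]).  Together they give G = F^a H with H of degree
    at most k + 2, so that g = f^a h for the homogenization h of H.  Finally
    {f, f^a h} = f^a {f, h}, and cancelling f^a leaves f w = {f, h}. *)

Set Implicit Arguments.
Unset Strict Implicit.
Unset Printing Implicit Defensive.

Import Order.TTheory GRing.Theory Num.Theory.

Local Open Scope ring_scope.

(** * Weighted Wronskians of univariate polynomials *)

Section Univariate.
Variable K : numClosedFieldType.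
Implicit Types (F G P Q U V W : {poly K}) (z : K).

(** Over an algebraically closed field a nonzero polynomial is, up to a constant,
    the product of its linear factors, and these can be cancelled one at a
    time. *)
Lemma dvdp_mup P Q :
  P != 0 -> Q != 0 -> (forall z, mup z P <= mup z Q)%N -> P %| Q.
Proof.
have [n] := ubnP (size P); elim: n P Q => // n IHn P Q /ltnSE leP P0 Q0 le_mup.
have [sP|/closed_rootP[z Pz]] := boolP (size P == 1).
  by rewrite (eqp_dvdl _ (_ : P %= 1)) ?dvd1p // -size_poly_eq1.
have /factor_theorem[P' defP] := Pz.
have P'0 : P' != 0 by apply: contraNneq P0 => P'0; rewrite defP P'0 mul0r.
have X0 : 'X - z%:P != 0 by rewrite polyXsubC_eq0.
have Qz : root Q z.
  rewrite -dvdp_XsubCl XsubC_dvd //; apply: leq_trans (le_mup z).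
  by rewrite -XsubC_dvd // dvdp_XsubCl.
have /factor_theorem[Q' defQ] := Qz.
have Q'0 : Q' != 0 by apply: contraNneq Q0 => Q'0; rewrite defQ Q'0 mul0r.
rewrite defP defQ dvdp_mul2r //; apply: IHn => // [|y].
  by move: leP; rewrite defP size_Mmonic ?monicXsubC // size_XsubC addn2.
by have := le_mup y; rewrite defP defQ !mupM // leq_add2r.
Qed.

(** This is what {f, g} becomes on the line x = 1 when f and g are homogeneous of
    degrees d and m; it vanishes when G^d is proportional to F^m. *)
Definition wronskian d m F G := d%:R *: (F * G^`()) - m%:R *: (F^`() * G).

(** The expansion at z of the Wronskian of two polynomials of orders e and s at z;
    one more factor X - z on both sides avoids the exponents e - 1 and s - 1. *)
Lemma mul_XsubC_wronskian d m e s z U V :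
  ('X - z%:P) *
    wronskian d m (('X - z%:P) ^+ e * V) (('X - z%:P) ^+ s * U) =
  ('X - z%:P) ^+ (e + s) *
    ((d%:R * s%:R - m%:R * e%:R)%:P * (V * U)
     + ('X - z%:P) * wronskian d m V U).
Proof.
have dX n : ('X - z%:P) * (('X - z%:P) ^+ n)^`() = n%:R%:P * ('X - z%:P) ^+ n.
  rewrite deriv_exp derivXsubC mul1r mulrnAr mul_polyC scaler_nat.
  case: n => [|n]; first by rewrite !mulr0n.
  by rewrite -exprS.
rewrite /wronskian !derivM -!mul_polyC exprD rmorphB !rmorphM /=.
have := dX e; have := dX s.
move: ('X - z%:P) => x; set xe := (x ^+ e)^`(); set xs := (x ^+ s)^`().
move=> eqs eqe.
transitivity (d%:R%:P * (x ^+ e * V * (x * xs * U + x * (x ^+ s * U^`())))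
  - m%:R%:P * ((x * xe * V + x * (x ^+ e * V^`())) * (x ^+ s * U))).
  by ring.
by rewrite eqs eqe; ring.
Qed.

(** If G vanished to an order s < e a at z, e being the order of F, then the
    Wronskian would have the order e + s - 1 exactly, since the coefficient
    d s - (a d + k) e of the lowest term is negative; but its order is at least
    e (a + 1). *)
Lemma mup_le_of_dvd_wronskian d a k F G z : (0 < k)%N -> F != 0 -> G != 0 ->
  F ^+ a.+1 %| wronskian d (a * d + k) F G -> (mup z (F ^+ a) <= mup z G)%N.
Proof.
move=> k0 F0 G0 dvdW.
have [e [V]] := multiplicity_XsubC F z; rewrite F0 /= => Vz defF.
have [s [U]] := multiplicity_XsubC G z; rewrite G0 /= => Uz defG.
have X0 : 'X - z%:P != 0 by rewrite polyXsubC_eq0.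
have -> : mup z G = s by rewrite defG mupMr // mup_XsubCX eqxx.
have -> : mup z (F ^+ a) = (e * a)%N.
  rewrite defF exprMn mupMr ?mup_XsubCX ?eqxx -?exprM ?mup_XsubCX ?eqxx //.
  by rewrite /root horner_exp expf_neq0.
rewrite leqNgt; apply/negP => lt_s.
have : ('X - z%:P) ^+ (e + s).+1 %| ('X - z%:P) * wronskian d (a * d + k) F G.
  rewrite exprS dvdp_mul2l //; apply: dvdp_trans dvdW.
  rewrite defF exprMn dvdp_mull // -exprM dvdp_exp2l //; lia.
rewrite defF defG ![_ * ('X - _) ^+ _]mulrC mul_XsubC_wronskian.
rewrite exprSr dvdp_mul2l ?expf_neq0 // dvdp_addl ?dvdp_mulIl //.
rewrite dvdp_XsubCl /root !hornerE mulf_eq0 mulf_eq0.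
rewrite (negPf (Vz : V.[z] != 0)) (negPf (Uz : U.[z] != 0)) !orbF.
rewrite -!natrM subr_eq0 eqr_nat => /eqP eqds.
have e0 : (0 < e)%N by case: (e) lt_s.
have : (0 < k * e)%N by rewrite muln_gt0 k0.
have : (d * s <= d * (e * a))%N by rewrite leq_mul2l ltnW ?orbT.
move: eqds; clear; nia.
Qed.

(** The analogue of [mup_le_of_dvd_wronskian] for the point at infinity: with p and
    q the degrees of F and G, the coefficient of degree p + q - 1 of the Wronskian
    is d q - (a d + k) p times the leading coefficients.  It is nonzero if
    q > a p + k, while F^(a+1) W is of smaller degree if moreover
    deg W <= k - 2. *)
Lemma size_le_of_wronskian d a k F G W : (0 < d)%N -> (0 < k)%N ->
  (size F <= d.+1)%N -> F != 0 -> G != 0 -> (size W <= k.-1)%N ->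
  wronskian d (a * d + k) F G = F ^+ a.+1 * W ->
  (size G <= a * (size F).-1 + k.+1)%N.
Proof.
move=> d0 k0 leF F0 G0 leW eqW; rewrite leqNgt; apply/negP => ltG.
have [p sF] : {p | size F = p.+1} by exists (size F).-1; rewrite -polySpred.
have [q sG] : {q | size G = q.+1} by exists (size G).-1; rewrite -polySpred.
have coefXd P n : ('X * P^`())`_n = n%:R * P`_n.
  rewrite coefXM; case: n => [|n]; first by rewrite mul0r.
  by rewrite coef_deriv /= mulr_natl.
have topM P Q : (size P <= p.+1)%N -> (size Q <= q.+1)%N ->
    (P * Q)`_(p + q) = P`_p * Q`_q.
  move=> sP sQ; rewrite coefM (bigD1 (inord p)) //= inordK ?ltnS ?leq_addr //.
  rewrite addKn big1 ?addr0 // => i.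
  rewrite -val_eqE /= inordK ?ltnS ?leq_addr // => ne.
  have [ltp|lep] := ltnP p i.
    by rewrite nth_default ?mul0r // (leq_trans sP ltp).
  by rewrite (nth_default _ (leq_trans sQ _)) ?mulr0 //; lia.
have sXd P n : (size P <= n.+1)%N -> (size ('X * P^`())%R <= n.+1)%N.
  move=> sP; apply/leq_sizeP => j ltj.
  by rewrite coefXd nth_default ?mulr0 // (leq_trans sP ltj).
(* Multiplying by X turns both derivatives into the Euler operator X d/dX, which
   preserves degrees. *)
have : ('X * wronskian d (a * d + k) F G)`_(p + q) = 0.
  rewrite eqW nth_default //.
  have sFa : (size (F ^+ a.+1) <= (p * a.+1).+1)%N.
    by have := size_exp F a.+1; rewrite sF => <-; apply: leqSpred.
  have := size_polyMleq (F ^+ a.+1) W; have := size_polyMleq 'X (F ^+ a.+1 * W).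
  rewrite size_polyX; move: ltG leW k0 sFa; rewrite sF sG /=; clear.
  set u := size (F ^+ _); set v := size W; set w := size (F ^+ _ * W).
  set y := size _; nia.
rewrite /wronskian mulrBr -!scalerAr mulrCA ['X * (_^`() * G)]mulrA coefB !coefZ.
rewrite !topM ?sXd ?sF ?sG // !coefXd.
have -> : F`_p = lead_coef F by rewrite /lead_coef sF.
have -> : G`_q = lead_coef G by rewrite /lead_coef sG.
set lF := lead_coef F; set lG := lead_coef G.
move=> eq0; have : (d%:R * q%:R - (a * d + k)%N%:R * p%:R) * (lF * lG) = 0.
  by rewrite -eq0; ring.
move/eqP; rewrite !mulf_eq0 !lead_coef_eq0 (negPf F0) (negPf G0) !orbF.
rewrite -!natrM subr_eq0 eqr_nat; apply/negP.
move: ltG leF; rewrite sF sG /= => ltG leF.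
have : (a * p + k < q)%N by lia.
have : (p <= d)%N by lia.
move: d0 k0; clear => d0 k0 lepd ltq.
have : (d * (a * p + k).+1 <= d * q)%N by rewrite leq_mul2l ltq orbT.
have : (k * p <= k * d)%N by rewrite leq_mul2l lepd orbT.
nia.
Qed.

Lemma dvd_wronskian d a k F G W : (0 < d)%N -> (0 < k)%N ->
  (size F <= d.+1)%N -> F != 0 -> (size W <= k.-1)%N ->
  wronskian d (a * d + k) F G = F ^+ a.+1 * W ->
  exists2 H, G = F ^+ a * H & (size H <= k.+1)%N.
Proof.
move=> d0 k0 leF F0 leW eqW.
have [->|G0] := eqVneq G 0; first by exists 0; rewrite ?mulr0 ?size_poly0.
have /dvdpP[H defG] : F ^+ a %| G.
  apply: dvdp_mup; rewrite ?expf_neq0 // => z.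
  by apply: (@mup_le_of_dvd_wronskian d a k); rewrite // eqW dvdp_mulr.
exists H; first by rewrite mulrC.
have := size_le_of_wronskian d0 k0 leF F0 G0 leW eqW.
have H0 : H != 0 by apply: contraNneq G0 => H0; rewrite defG H0 mul0r.
have /polySpred sFa : F ^+ a != 0 by rewrite expf_neq0.
by rewrite defG size_mul ?expf_neq0 // sFa size_exp addnS mulnC addnC leq_add2l.
Qed.
End Univariate.

(** * Homogeneous polynomials in two variables and the line x = 1 *)

Section Bivariate.
Variable K : numClosedFieldType.
Implicit Types (p q f g : {mpoly K[2]}) (Q : {poly K}).
Implicit Types (m : 'X_{1..2}) (n d e : nat).

Lemma mdeg2 m : mdeg m = (m 0%R + m 1%R)%N.
Proof.
rewrite mdegE !big_ord_recl big_ord0 addn0; congr (m _ + m _)%N.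
exact: val_inj.
Qed.

Lemma dhomog_mderiv n i p : p \is n.+1.-homog -> p^`M(i) \is n.-homog.
Proof.
move=> /dhomogP hp; apply/dhomogP => m.
rewrite mcoeff_msupp mcoeff_mderiv => nz.
have /hp : (m + U_(i))%MM \in msupp p.
  by rewrite mcoeff_msupp; apply: contraNneq nz => ->; rewrite mul0rn.
by rewrite /= mdegD mdeg1 addn1 => -[].
Qed.

Lemma dhomog0_mderiv i p : p \is 0.-homog -> p^`M(i) = 0.
Proof.
move=> hp; apply/mpolyP => m; rewrite mcoeff_mderiv mcoeff0.
by rewrite (dhomog_nemf_coeff hp) ?mul0rn //= mdegD mdeg1 addn1.
Qed.

Lemma pihomogMl d n p q : p \is d.-homog ->
  pihomog mdeg (d + n) (p * q) = p * pihomog mdeg n q.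
Proof.
move=> hp; elim/mpolyind: q => [|c m q _ _ IHq].
  by rewrite !(mulr0, pihomog0).
rewrite mulrDr !pihomogD IHq mulrDr; congr (_ + _).
rewrite -scalerAr !linearZ /= -scalerAr; congr (_ *: _).
have hpm : p * 'X_[m] \is (d + mdeg m).-homog by rewrite dhomogM ?dhomogX.
rewrite pihomogX; case: eqP => [<-|/eqP ne]; first by rewrite pihomog_dE.
by rewrite mulr0 (pihomog_ne0 _ hpm) // eqn_add2l.
Qed.

Lemma pihomogMl_lt d n p q : (n < d)%N -> p \is d.-homog ->
  pihomog mdeg n (p * q) = 0.
Proof.
move=> ltnd hp; elim/mpolyind: q => [|c m q _ _ IHq].
  by rewrite mulr0 pihomog0.
rewrite mulrDr pihomogD IHq addr0 -scalerAr linearZ /=.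
have hpm : p * 'X_[m] \is (d + mdeg m).-homog by rewrite dhomogM ?dhomogX.
rewrite (pihomog_ne0 _ hpm) ?scaler0 // gtn_eqF //.
by rewrite (leq_trans ltnd) ?leq_addr.
Qed.

Lemma euler_identity n p : p \is n.-homog ->
  'X_0 * p^`M(0) + 'X_1 * p^`M(1) = n%:R *: p.
Proof.
move=> /dhomogP hp; rewrite [p in RHS]mpolyE scaler_sumr.
rewrite [p in p^`M(0)]mpolyE [p in p^`M(1)]mpolyE !raddf_sum /= !mulr_sumr.
rewrite -big_split /=; apply: eq_big_seq => m /hp; rewrite /= mdeg2 => <-.
have XdX i : 'X_i * 'X_[m]^`M(i) = (m i)%:R *: 'X_[m] :> {mpoly K[2]}.
  rewrite mderivX -scalerAr -mpolyXD.
  have [->|m0] := eqVneq (m i) 0%N; first by rewrite !scale0r.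
  by rewrite addmC submK // lep1mP.
by rewrite !mderivZ -!scalerAr !XdX natrD scalerDl !scalerA ![p@_m * _]mulrC.
Qed.

(** The substitution x = 1, y = X. *)
Definition dehom : {mpoly K[2]} -> {poly K} :=
  mmap (@polyC K) (fun i : 'I_2 => if i == 0 then 1 else 'X).

HB.instance Definition _ := GRing.RMorphism.on dehom.

Lemma dehomZ c p : dehom (c *: p) = c *: dehom p.
Proof. by rewrite /dehom mmapZ mul_polyC. Qed.

Lemma dehomX m : dehom 'X_[m] = 'X^(m 1%R).
Proof.
rewrite /dehom mmapX /mmap1 !big_ord_recl big_ord0 /= expr1n mul1r mulr1.
by congr ('X^(m _)); apply: val_inj.
Qed.

Lemma dehomE p : dehom p = \sum_(m <- msupp p) p@_m *: 'X^(m 1%R).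
Proof.
rewrite {1}[p]mpolyE rmorph_sum /=; apply: eq_bigr => m _.
by rewrite dehomZ dehomX.
Qed.

Lemma deriv_dehom p : (dehom p)^`() = dehom p^`M(1).
Proof.
elim/mpolyind: p => [|c m p _ _ IHp].
  by rewrite mderiv0 !rmorph0 deriv0.
rewrite mderivD !rmorphD /= derivD IHp; congr (_ + _).
rewrite mderivZ !dehomZ derivZ mderivX dehomZ !dehomX derivXn scaler_nat.
by rewrite mnmBE mnm1E eqxx subn1.
Qed.

Lemma dehom_euler n p : p \is n.-homog ->
  dehom p^`M(0) = n%:R *: dehom p - 'X * (dehom p)^`().
Proof.
move=> hp; rewrite -dehomZ -(euler_identity hp) rmorphD !rmorphM /=.
by rewrite !dehomX deriv_dehom !mnm1E expr0 mul1r expr1 addrK.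
Qed.

Lemma size_dehom n p : p \is n.-homog -> (size (dehom p) <= n.+1)%N.
Proof.
move=> /dhomogP hp; rewrite dehomE; apply/leq_sizeP => j ltj.
rewrite coef_sum big1_seq // => m /andP[_ /hp /= degm].
rewrite coefZ coefXn gtn_eqF ?mulr0 // (leq_trans _ ltj) // ltnS.
by rewrite -degm mdeg2 leq_addl.
Qed.

(** A monomial of given degree is determined by its exponent in y, so no two terms
    of a homogeneous polynomial are merged by x = 1. *)
Lemma dehom_eq0 n p : p \is n.-homog -> dehom p = 0 -> p = 0.
Proof.
move=> /dhomogP hp p0; apply/eqP; rewrite -msupp_eq0.
case defs: (msupp p) => [//|m s].
have mp: m \in msupp p by rewrite defs mem_head.
have := congr1 (fun P : {poly K} => P`_(m 1%R)) p0.
rewrite dehomE coef0 coef_sum (bigD1_seq m) ?msupp_uniq //=.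
rewrite big1_seq => [|m' /andP[ne_m /hp /= degm']]; last first.
  rewrite coefZ coefXn; case: eqP => [eq1|]; last by rewrite mulr0.
  case/eqP: ne_m; apply/mnmP => i.
  have := hp m mp; rewrite /= -degm' !mdeg2 eq1 => /addIn eq0.
  have [->|i1] := eqVneq i 0 => //; suff -> : i = 1 by [].
  by apply: val_inj; case: i i1 => -[|[]].
rewrite addr0 coefZ coefXn eqxx mulr1 => /eqP.
by rewrite mcoeff_eq0 mp.
Qed.

Lemma dehom_surj n Q : (size Q <= n.+1)%N ->
  exists2 q, q \is n.-homog & dehom q = Q.
Proof.
move=> sQ.
exists (\sum_(i < n.+1) Q`_i *: 'X_[(U_(0%R) *+ (n - i) + U_(1%R) *+ i)%MM]).
  apply: rpred_sum => i _; apply: rpredZ.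
  by rewrite dhomogX /= mdegD !mdegMn !mdeg1 !mul1n subnK // -ltnS.
rewrite rmorph_sum /= [RHS](_ : Q = \poly_(i < n.+1) Q`_i); last first.
  apply/polyP => i; rewrite coef_poly.
  by case: ltnP => // /(leq_trans sQ)/leq_sizeP->.
rewrite poly_def; apply: eq_bigr => i _.
by rewrite dehomZ dehomX mnmDE !mulmnE !mnm1E /= mul0n mul1n.
Qed.

End Bivariate.

(** * The image of df /\ d *)

(** The same expression as [wedge (ext_d f) (ext_d g)], for coefficients that need
    not be R[i]. *)
Definition bracket (K : nzRingType) (f g : {mpoly K[2]}) :=
  f^`M(0) * g^`M(1) - f^`M(1) * g^`M(0).

Section Bracket.
Variable K : numClosedFieldType.
Implicit Types (f g h w : {mpoly K[2]}) (p : {poly K}).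

Lemma dehom_bracket d n f g : f \is d.-homog -> g \is n.-homog ->
  dehom (bracket f g) = wronskian d n (dehom f) (dehom g).
Proof.
move=> hf hg; rewrite /bracket rmorphB !rmorphM /= -!deriv_dehom.
rewrite (dehom_euler hf) (dehom_euler hg) /wronskian -!mul_polyC.
by ring.
Qed.

(** The hypothesis says that n is d + e - 2, without truncation. *)
Lemma dhomog_bracket d e n f g : (n.+2 = d + e)%N ->
  f \is d.-homog -> g \is e.-homog -> bracket f g \is n.-homog.
Proof.
rewrite /bracket.
case: d => [|d] Dn hf hg.
  by rewrite !(dhomog0_mderiv _ hf) !mul0r subrr rpred0.
case: e Dn hg => [|e] Dn hg.
  by rewrite !(dhomog0_mderiv _ hg) !mulr0 subrr rpred0.
have -> : n = (d + e)%N by move: Dn; rewrite addSn addnS => -[].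
by rewrite rpredB ?dhomogM ?dhomog_mderiv.
Qed.

Lemma bracket0 f : bracket f 0 = 0.
Proof. by rewrite /bracket !mderiv0 !mulr0 subrr. Qed.

Lemma bracketD f g h : bracket f (g + h) = bracket f g + bracket f h.
Proof. by rewrite /bracket !mderivD; ring. Qed.

Lemma bracketZ f c g : bracket f (c *: g) = c *: bracket f g.
Proof. by rewrite /bracket !mderivZ -!scalerAr scalerBr. Qed.

Lemma bracketM f g h : bracket f (g * h) = g * bracket f h + h * bracket f g.
Proof. by rewrite /bracket !mderivM; ring. Qed.

(** {f, -} is a derivation that kills f, hence it is linear over the polynomials
    in f. *)
Lemma bracketXl f n h : bracket f (f ^+ n * h) = f ^+ n * bracket f h.
Proof.
elim: n => [|n IHn]; first by rewrite expr0 !mul1r.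
rewrite exprS -mulrA bracketM IHn.
by rewrite [bracket f f]/bracket [f^`M(0) * _]mulrC subrr mulr0 addr0 mulrA.
Qed.

Lemma pihomog_bracket d e n f g : (0 < d)%N -> (n.+2 = d + e)%N ->
  f \is d.-homog ->
  pihomog mdeg n (bracket f g) = bracket f (pihomog mdeg e g).
Proof.
move=> d0 Dn hf; elim/mpolyind: g => [|c m g _ _ IHg].
  by rewrite bracket0 !pihomog0 bracket0.
rewrite bracketD pihomogD [pihomog _ e _]pihomogD bracketD IHg; congr (_ + _).
rewrite bracketZ !linearZ /= bracketZ; congr (_ *: _).
have hm : 'X_[K, m] \is (mdeg m).-homog by rewrite dhomogX.
rewrite pihomogX; case: eqP => [eqm|/eqP ne].
  by rewrite pihomog_dE // (dhomog_bracket _ hf hm) // eqm.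
rewrite bracket0; have [m0|m0] := posnP (mdeg m).
  rewrite m0 in hm.
  by rewrite /bracket !(dhomog0_mderiv _ hm) !mulr0 subrr pihomog0.
have Dm : ((d + mdeg m).-2.+2 = d + mdeg m)%N by lia.
rewrite (pihomog_ne0 _ (dhomog_bracket Dm hf hm)) //.
by rewrite -eqSS -eqSS Dm Dn eqn_add2l.
Qed.

Definition in_image f w : Prop := exists h, w = bracket f h.

Lemma in_image0 f : in_image f 0.
Proof. by exists 0; rewrite bracket0. Qed.

Lemma in_imageD f w1 w2 :
  in_image f w1 -> in_image f w2 -> in_image f (w1 + w2).
Proof. by case=> h1 -> [h2 ->]; exists (h1 + h2); rewrite bracketD. Qed.

Lemma in_imageZ f c w : in_image f w -> in_image f (c *: w).
Proof. by case=> h ->; exists (c *: h); rewrite bracketZ. Qed.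

Lemma in_imageX f n w : in_image f w -> in_image f (f ^+ n * w).
Proof. by case=> h ->; exists (f ^+ n * h); rewrite bracketXl. Qed.

Lemma in_image_sum f (I : Type) (r : seq I) (P : pred I)
    (F : I -> {mpoly K[2]}) :
  (forall i, P i -> in_image f (F i)) -> in_image f (\sum_(i <- r | P i) F i).
Proof.
move=> imF; apply: (big_ind (in_image f)) => //; first exact: in_image0.
exact: in_imageD.
Qed.

(** Here g / f^a is shown to be a polynomial: [dvd_wronskian] does it on the line
    x = 1, with the degree bound that allows homogenizing back. *)
Lemma homog_torsion_killed d a k f w : (0 < d)%N -> f != 0 ->
  f \is d.-homog -> w \is k.-homog ->
  in_image f (f ^+ a.+1 * w) -> in_image f (f * w).
Proof.
move=> d0 f0 hf hw [g0 eq_g0].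
(* Only the component of this degree of g0 contributes to f^(a+1) w. *)
pose n := (a * d + k.+2)%N; pose g := pihomog mdeg n g0.
have hg : g \is n.-homog by apply: pihomogP.
have hfX b : f ^+ b \is (b * d).-homog by rewrite mulnC dhomogMn.
have eq_g : f ^+ a.+1 * w = bracket f g.
  have hfw : f ^+ a.+1 * w \is (a.+1 * d + k).-homog by rewrite dhomogM.
  rewrite /g -(@pihomog_bracket d n (a.+1 * d + k)) //; last by rewrite /n; lia.
  by rewrite -eq_g0 pihomog_dE.
have F0 : dehom f != 0 by apply: contraNneq f0 => /(dehom_eq0 hf)->.
have [||||||H eqG sH] :=
  @dvd_wronskian _ d a k.+2 (dehom f) (dehom g) (dehom w).
- by [].
- by [].
- exact: size_dehom.
- by [].
- exact: size_dehom.
- by rewrite -dehom_bracket // -eq_g rmorphM rmorphXn.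
have [h hh eqh] := dehom_surj sH.
have eqgh : g = f ^+ a * h.
  apply/eqP; rewrite -subr_eq0; apply/eqP; apply: (@dehom_eq0 _ n).
    by rewrite rpredB // dhomogM.
  by rewrite rmorphB rmorphM rmorphXn /= eqh eqG subrr.
exists h; apply: (mulfI (expf_neq0 a f0)).
by rewrite mulrA -exprSr eq_g eqgh bracketXl.
Qed.

Lemma horner_algE f p :
  horner_alg f p = \sum_(j < size p) p`_j *: f ^+ j.
Proof.
rewrite /horner_alg /horner_morph horner_coef size_map_poly.
by apply: eq_bigr => j _; rewrite coef_map /= -scalerAl mul1r.
Qed.

(** In degree (a + 1) d + k the product f p(f) w is the sum of p_a f^(a+1) w_k and
    of the p_j f^(j+1) w_(k - (j - a) d) with j > a; the latter lie in the image by
    induction on k.  The extra factor f makes the degree at least d - 2, so that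
    the component is itself a value of {f, -} and not only a truncation. *)
Lemma torsion_component d a p f w k : (0 < d)%N -> f \is d.-homog ->
  p`_a != 0 -> (forall j, (j < a)%N -> p`_j = 0) ->
  in_image f (horner_alg f p * w) ->
  in_image f (f ^+ a.+1 * pihomog mdeg k w).
Proof.
move=> d0 hf pa p_lt [g eq_g].
elim/ltn_ind: k => k IHk.
pose n := (a.+1 * d + k)%N.
have hfX b : f ^+ b \is (b * d).-homog by rewrite mulnC dhomogMn.
have lta : (a < size p)%N.
  by rewrite ltnNge; apply: contra pa => /leq_sizeP->.
have top : in_image f (pihomog mdeg n (f * (horner_alg f p * w))).
  exists (pihomog mdeg (a * d + k.+2) (f * g)).
  rewrite -(@pihomog_bracket d _ n) //; last by rewrite /n; lia.
  by rewrite eq_g -[f in f * g]expr1 bracketXl.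
have hornerE :
    f * (horner_alg f p * w) = \sum_(j < size p) p`_j *: (f ^+ j.+1 * w).
  rewrite horner_algE mulr_suml mulr_sumr; apply: eq_bigr => j _.
  by rewrite -scalerAl -scalerAr mulrA exprS.
have defn : pihomog mdeg n (f * (horner_alg f p * w)) =
    p`_a *: (f ^+ a.+1 * pihomog mdeg k w)
    + \sum_(j < size p | j != a :> nat) p`_j *: pihomog mdeg n (f ^+ j.+1 * w).
  rewrite hornerE linear_sum (bigD1 (Ordinal lta)) //=; congr (_ + _).
    by rewrite linearZ /= (pihomogMl _ _ (hfX _)).
  by apply: eq_bigr => j _; rewrite linearZ.
have rest : in_image f
    (\sum_(j < size p | j != a :> nat) p`_j *: pihomog mdeg n (f ^+ j.+1 * w)).
  apply: in_image_sum => j ne_ja.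
  have [ltja|leaj] := ltnP j a.
    by rewrite p_lt // scale0r; apply: in_image0.
  apply: in_imageZ.
  have [lejn|ltnj] := leqP (j.+1 * d) n; last first.
    by rewrite (pihomogMl_lt _ ltnj) //; apply: in_image0.
  have ltaj : (a < j)%N by rewrite ltn_neqAle eq_sym ne_ja.
  rewrite -(subnKC lejn) pihomogMl // -(subnK leaj) -addnS exprD -mulrA.
  apply: in_imageX; apply: IHk.
  have : (a.+2 * d <= j.+1 * d)%N by rewrite leq_mul2r ltnS ltaj orbT.
  rewrite addnS subnK //; move: lejn; rewrite /n; lia.
have -> : f ^+ a.+1 * pihomog mdeg k w =
    (p`_a)^-1 *: (pihomog mdeg n (f * (horner_alg f p * w))
      + (-1) *: \sum_(j < size p | j != a :> nat)
          p`_j *: pihomog mdeg n (f ^+ j.+1 * w)).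
  by rewrite defn scaleN1r addrK scalerA mulVf // scale1r.
by apply: in_imageZ; apply: in_imageD => //; apply: in_imageZ.
Qed.

Lemma torsion_killed d p f w : (0 < d)%N -> f != 0 -> f \is d.-homog ->
  p != 0 -> in_image f (horner_alg f p * w) -> in_image f (f * w).
Proof.
move=> d0 f0 hf p0 pw.
have ex_j : exists j, p`_j != 0.
  by exists (size p).-1; rewrite -[_`__]/(lead_coef p) lead_coef_eq0.
case: (ex_minnP ex_j) => a pa min_a.
have p_lt j : (j < a)%N -> p`_j = 0.
  by move=> ltja; apply/eqP; apply: contraLR ltja => /min_a; rewrite -leqNgt.
rewrite (pihomog_partitionE (mf := mdeg) (leqnn (mmeasure mdeg w))) mulr_sumr.
apply: in_image_sum => j _.
have hw : pihomog mdeg j w \is j.-homog by apply: pihomogP.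
exact: homog_torsion_killed d0 f0 hf hw (torsion_component _ d0 hf pa p_lt pw).
Qed.

End Bracket.

(** * The torsion order *)

Theorem corollary2p2 (R : realType) (d : nat) (f : {mpoly R[i][2]})
    (d_gt1 : (1 < d)%N)
    (f_homog : f \is d.-homog)
    (f_not_power : ~ exists (g : {mpoly R[i][2]}) (r : nat),
        (1 < r)%N /\ f = g ^+ r)
    (f_nonisolated : nonisolated_singularity_at_origin f) :
  torsion_order f = 1%N.
Proof.
have f0 : f != 0.
  (* The zero polynomial is the square of itself. *)
  by apply/eqP => f0; apply: f_not_power; exists 0, 2%N; rewrite f0 expr0n.
have form_class0 u : form_class f u = 0 <-> in_image f u.
  rewrite -(raddf0 (form_class f)); split=> [/form_classP|] [g eqg].
    by exists g; rewrite -[u]subr0.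
  by apply/form_classP; exists g; rewrite subr0.
have kill1 : kills_torsion f 1.
  move=> m [p p0]; have [w ->] := form_class_surj m => pw0.
  rewrite expr1 brieskorn_scaleX; apply/form_class0.
  apply: (torsion_killed (ltnW d_gt1) f0 f_homog p0).
  by apply/form_class0; rewrite -brieskorn_scaleE.
apply: xget_unique => [|N [N0 _ minN]]; first by split.
by apply/eqP; rewrite eqn_leq N0 minN.
Qed.
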